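(* The following groups do not embed in Thompson's group $V$: (1) the Basilica group; (2) the Hanoï Towers groups $H^{(m)}$, $m\ge 3$.
   Context: Thompson's group $V$: let $\mathfrak C=\{0,1\}^{\infty}$ be the Cantor set, and for $a\in\{0,1\}^*$ let $[a]=\{a\eta:\eta\in\{0,1\}^\infty\}$. $V$ is the group of all homeomorphisms of $\mathfrak C$ of the form $a_j\eta\mapsto b_j\eta$ ($\eta\in\{0,1\}^\infty$, $j=1,\dots,m$), where $\mathfrak C=[a_1]\sqcup\dots\sqcup[a_m]=[b_1]\sqcup\dots\sqcup[b_m]$. Automorphisms of the $d$-ary rooted tree $T_d$ are written $(g_1,\dots,g_d)\sigma$, where $\sigma\in\mathrm{Sym}(d)$ is the action on the first level and $g_i\in\mathrm{Aut}(T_d)$ is the section at the $i$-th first-level vertex. The Basilica group is the subgroup $\langle a,b\rangle\le\mathrm{Aut}(T_2)$, where $a=(1,b)$ and $b=(1,a)\sigma$ with $\sigma$ the transposition of the two first-level vertices. The Hanoï Towers group $H^{(m)}$ on $m$ pegs is the subgroup of $\mathrm{Aut}(T_m)$ generated by the automorphisms $a_{ij}$ ($1\le i<j\le m$), where $a_{ij}=(g_1,\dots,g_m)(i\,j)$ with $g_i=g_j=1$ and $g_k=a_{ij}$ for $k\ne i,j$; i.e. $a_{ij}$ acts on words over $\{1,\dots,m\}$ by swapping the first occurring letter that belongs to $\{i,j\}$ ($i\leftrightarrow j$) and fixing the rest. *)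

(* Defs.v *)
From HB Require Import structures.
From mathcomp Require Import all_boot all_fingroup.
From mathcomp Require Import boolp classical_sets topology cantor.

Set Implicit Arguments.
Unset Strict Implicit.
Unset Printing Implicit Defensive.

Local Open Scope classical_set_scope.
Local Open Scope group_scope.

Record bijection (T : Type) := Bijection {
  bij_fun :> T -> T;
  bij_inv : T -> T;
  bij_funK : cancel bij_fun bij_inv;
  bij_invK : cancel bij_inv bij_fun
}.

Section BijectionGroup.
Variable T : Type.
Implicit Types f g h : bijection T.

Lemma bijectionP f g : f =1 g -> f = g.
Proof.
case: f g => [f f' fK f'K] [g g' gK g'K] /= /funext fg.
case: _ / fg in gK g'K *.
have fg' : f' = g' by apply/funext => x; rewrite -{1}[x]g'K fK.
case: _ / fg' in gK g'K *.
by congr Bijection; exact: Prop_irrelevance.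
Qed.

HB.instance Definition _ := gen_eqMixin (bijection T).
HB.instance Definition _ := gen_choiceMixin (bijection T).

Definition bij_one : bijection T :=
  @Bijection T id id (fun=> erefl) (fun=> erefl).
Definition bij_mul f g : bijection T :=
  Bijection (can_comp (bij_funK f) (bij_funK g))
            (can_comp (bij_invK g) (bij_invK f)).
Definition bij_opp f : bijection T := Bijection (bij_invK f) (bij_funK f).

Fact bij_mulA : associative bij_mul.
Proof. by move=> f g h; exact: bijectionP. Qed.
Fact bij_mul1 : left_id bij_one bij_mul.
Proof. by move=> f; exact: bijectionP. Qed.
Fact bij_mulr1 : right_id bij_one bij_mul.
Proof. by move=> f; exact: bijectionP. Qed.
Fact bij_mulV : left_inverse bij_one bij_opp bij_mul.
Proof. by move=> f; apply: bijectionP => x /=; exact: bij_funK. Qed.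
Fact bij_mulrV : right_inverse bij_one bij_opp bij_mul.
Proof. by move=> f; apply: bijectionP => x /=; exact: bij_invK. Qed.

HB.instance Definition _ :=
  isGroup.Build (bijection T) bij_mulA bij_mul1 bij_mulr1 bij_mulV bij_mulrV.

(* [f * g] is "first g, then f". *)
Lemma bij_mulE f g x : (f * g) x = f (g x). Proof. by []. Qed.
Lemma bij_oneE x : (1 : bijection T) x = x. Proof. by []. Qed.
Lemma bij_invE f : bij_fun f^-1 = bij_inv f. Proof. by []. Qed.

End BijectionGroup.

(* The underlying set is deliberately not a coercion: a [subgroup] coerces
   only to a type and to a [groupType]. *)
Record subgroup (G : groupType) := Subgroup {
  subgroup_set : set G;
  subgroup_closed : group_closed (mem subgroup_set)
}.

Definition subgroup_type (G : groupType) (H : subgroup G) : Type :=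
  {x : G | x \in subgroup_set H}.
Coercion subgroup_type : subgroup >-> Sortclass.

Section SubgroupType.
Variables (G : groupType) (H : subgroup G).
HB.instance Definition _ := SubChoice.on (subgroup_type H).
HB.instance Definition _ :=
  SubChoice_isSubGroup.Build G (fun x => x \in subgroup_set H)
    (subgroup_type H) (subgroup_closed H).
End SubgroupType.

Definition subgroup_group (G : groupType) (H : subgroup G) : groupType :=
  subgroup_type H.
Coercion subgroup_group : subgroup >-> Group.type.

Fact group_closed_set (G : groupType) (S : set G) :
    S 1 -> (forall x y, S x -> S y -> S (x * y)) -> (forall x, S x -> S x^-1) ->
  group_closed (mem S).
Proof.
move=> S1 SM SV; split; first exact/mem_set.
by move=> x y /set_mem Sx /set_mem Sy; apply/mem_set/SM => //; exact: SV.
Qed.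

Section Generated.
Variables (G : groupType) (S : set G).

Definition generated_set : set G :=
  smallest (fun H : set G => group_closed (mem H)) S.

Fact generated_closed : group_closed (mem generated_set).
Proof.
apply: group_closed_set => [H [[+ _] _]|x y Sx Sy H HP|x Sx H HP].
- by move/set_mem.
- have [cH _] := HP; have [_ HM] := (cH.1, group_closedM cH).
  by apply: set_mem; apply: HM; apply/mem_set; [exact: Sx|exact: Sy].
- have [cH _] := HP; apply: set_mem; apply: (group_closedV cH).
  by apply/mem_set; exact: Sx.
Qed.

Definition generated : subgroup G := Subgroup generated_closed.
End Generated.

Definition embeds (G H : groupType) : Prop :=
  exists phi : {multiplicative G -> H}, injective phi.

Definition homeomorphism (X : topologicalType) (f : bijection X) : Prop :=
  continuous (bij_fun f) /\ continuous (bij_inv f).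

Section Thompson.
Implicit Types (a b u v w : seq bool) (xi eta : cantor_space).

Definition prepend a eta : cantor_space :=
  fun n => if n < size a then nth false a n else eta (n - size a).

Definition cylinder a : set cantor_space := range (prepend a).

Definition cylinder_partition m (a : 'I_m -> seq bool) : Prop :=
  trivIset setT (fun j => cylinder (a j)) /\
  \bigcup_(j in setT) cylinder (a j) = setT.

Definition thompson_set : set (bijection cantor_space) :=
  [set f | homeomorphism f /\
    exists m (a b : 'I_m -> seq bool),
      [/\ cylinder_partition a, cylinder_partition b &
          forall j eta, f (prepend (a j) eta) = prepend (b j) eta]].

Lemma prepend_cat u v eta : prepend (u ++ v) eta = prepend u (prepend v eta).
Proof.
apply/funext => n; rewrite /prepend size_cat nth_cat.
case: (ltnP n (size u)) => [nu|un]; first by rewrite (leq_trans nu) ?leq_addr.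
by rewrite ltn_subLR // subnDA.
Qed.

Definition drop_seq n xi : cantor_space := fun k => xi (n + k).

Lemma prefixK n xi : prepend (mkseq xi n) (drop_seq n xi) = xi.
Proof.
apply/funext => k; rewrite /prepend /drop_seq size_mkseq.
by case: ltnP => [kn|nk]; [rewrite nth_mkseq|rewrite subnKC].
Qed.

Lemma mkseq_prepend u eta : mkseq (prepend u eta) (size u) = u.
Proof.
apply: (@eq_from_nth _ false); rewrite size_mkseq // => i iu.
by rewrite nth_mkseq // /prepend iu.
Qed.

Lemma prepend_inj u : injective (prepend u).
Proof.
move=> x y /(congr1 (fun z => drop_seq (size u) z)) E; apply/funext => k.
have := congr1 (fun z => z k) E.
by rewrite /drop_seq /prepend /= ltnNge leq_addr /= addKn.
Qed.

Lemma prepend_inj_size u v x y :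
  size u = size v -> prepend u x = prepend v y -> u = v.
Proof. by move=> uv E; rewrite -(mkseq_prepend u x) E uv mkseq_prepend. Qed.

Lemma prepend_split u v xi eta : (size u <= size v)%N ->
  prepend u xi = prepend v eta -> v = u ++ drop (size u) v.
Proof.
move=> uv E; rewrite -{1}(cat_take_drop (size u) v); congr (_ ++ _).
rewrite -[RHS](mkseq_prepend u xi) E; apply: (@eq_from_nth _ false); first by rewrite size_mkseq size_takel.
move=> i; rewrite size_takel // => iu.
by rewrite nth_mkseq // nth_take // /prepend (leq_trans iu uv).
Qed.

Definition local_prefix (f : cantor_space -> cantor_space) (k : nat) : Prop :=
  forall n u, size u = (n + k)%N ->
    exists2 v, (n <= size v)%N & forall eta, f (prepend u eta) = prepend v eta.

Lemma local_prefix_table m (a b : 'I_m -> seq bool) f :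
    \bigcup_(j in setT) cylinder (a j) = setT ->
    (forall j eta, f (prepend (a j) eta) = prepend (b j) eta) ->
  exists k, local_prefix f k.
Proof.
move=> aT fab; exists (\max_j size (a j)) => n u su.
have : [set: cantor_space] (prepend u (fun=> false)) by [].
rewrite -aT => -[j _ [eta _ E]].
have ja : (size (a j) <= \max_i size (a i))%N by exact: leq_bigmax.
have au : (size (a j) <= size u)%N by rewrite su (leq_trans ja) ?leq_addl.
have := prepend_split au E; set u' := drop _ _ => uE.
exists (b j ++ u').
  by rewrite size_cat size_drop su -addnBA // (leq_trans _ (leq_addl _ _)) ?leq_addr.
by move=> x; rewrite uE !prepend_cat fab.
Qed.

Lemma thompson_local (f : bijection cantor_space) : homeomorphism f ->
  (exists k, local_prefix f k) -> thompson_set f.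
Proof.
move=> hf [k fk]; split=> //.
have /boolp.choice[F FE] : forall u : k.-tuple bool, exists v,
    forall eta, f (prepend u eta) = prepend v eta.
  by move=> u; have [|v _ vE] := fk 0%N u; [rewrite size_tuple|exists v].
pose a (j : 'I_#|{: k.-tuple bool}|) : seq bool := enum_val j.
exists #|{: k.-tuple bool}|, a, (fun j => F (enum_val j)); split.
- split.
    move=> i j _ _ [xi [[x _ <-] [y _]]] /esym E.
    apply: enum_val_inj; apply: val_inj.
    by apply: (prepend_inj_size _ E); rewrite !size_tuple.
  apply/seteqP; split=> // xi _.
  exists (enum_rank (mktuple (fun i : 'I_k => xi i))) => //.
  exists (drop_seq k xi) => //; rewrite /a enum_rankK.
  rewrite -[RHS](prefixK k); congr prepend.
  apply: (@eq_from_nth _ false); rewrite size_tuple ?size_mkseq // => i ik.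
  by rewrite nth_mkseq // -(tnth_nth _ _ (Ordinal ik)) tnth_mktuple.
- split.
    move=> i j _ _ [xi [[x _ <-] [y _]]] /esym.
    rewrite -!FE => /(can_inj (bij_funK f)) E.
    apply: enum_val_inj; apply: val_inj.
    by apply: (prepend_inj_size _ E); rewrite !size_tuple.
  apply/seteqP; split=> // xi _.
  pose z := bij_inv f xi.
  exists (enum_rank (mktuple (fun i : 'I_k => z i))) => //.
  exists (drop_seq k z) => //; rewrite enum_rankK -FE.
  rewrite -[RHS](bij_invK f); congr (bij_fun f _).
  rewrite -/z -[RHS](prefixK k); congr prepend.
  apply: (@eq_from_nth _ false); rewrite size_tuple ?size_mkseq // => i ik.
  by rewrite nth_mkseq // -(tnth_nth _ _ (Ordinal ik)) tnth_mktuple.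
- by move=> j eta; exact: FE.
Qed.

Fact thompson_closed : group_closed (mem thompson_set).
Proof.
apply: group_closed_set => [|f g|f].
- apply: thompson_local; first by split=> x; exact: cvg_id.
  by exists 0%N => n u su; exists u; rewrite ?su ?addn0.
- move=> [[cf cfV] [m [a [b [[_ aT] _ fab]]]]].
  move=> [[cg cgV] [p [c [d [[_ cT] _ gcd]]]]].
  apply: thompson_local.
    split=> x; first exact: continuous_comp (cg x) (cf _).
    exact: continuous_comp (cfV x) (cgV _).
  have [k fk] := local_prefix_table aT fab.
  have [l gl] := local_prefix_table cT gcd.
  exists (k + l)%N => n u su.
  have [|v nv gv] := gl (n + k)%N u; first by rewrite su addnA.
  have [|w nw fw] := fk (size v - k)%N v.
    by rewrite subnK // (leq_trans _ nv) ?leq_addl.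
  exists w; last by move=> eta; rewrite bij_mulE gv fw.
  by apply: leq_trans nw; rewrite leq_subRL ?(leq_trans _ nv) ?leq_addl // addnC.
- move=> [[cf cfV] [m [a [b [aP bP fab]]]]]; split; first by split.
  exists m, b, a; split=> // j eta.
  by apply: (can_inj (bij_funK f)); rewrite fab; exact: bij_invK.
Qed.

Definition thompsonV : subgroup (bijection cantor_space) :=
  Subgroup thompson_closed.

End Thompson.

Section Tree.
Variable d : nat.
Implicit Types (u v w : seq 'I_d).

Definition tree_edge u v : Prop :=
  exists x, v = rcons u x \/ u = rcons v x.

Definition tree_aut_set : set (bijection (seq 'I_d)) :=
  [set f | f [::] = [::] /\ forall u v, tree_edge u v <-> tree_edge (f u) (f v)].

Fact tree_aut_closed : group_closed (mem tree_aut_set).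
Proof.
apply: group_closed_set => [|f g [f0 fE] [g0 gE]|f [f0 fE]].
- by [].
- split=> [|u v]; first by rewrite bij_mulE g0.
  by rewrite !bij_mulE -fE -gE.
- split=> [|u v]; first by rewrite -[in LHS]f0; exact: bij_funK.
  by have := fE (bij_inv f u) (bij_inv f v); rewrite !bij_invK => ->.
Qed.

Definition tree_aut : subgroup (bijection (seq 'I_d)) :=
  Subgroup tree_aut_closed.

(* Letters are numbered from 0, so [wreath_decomposition g gs s] reads
   [g = (gs 0, ..., gs (d - 1)) s]; [gs x] is the section at the vertex [x],
   i.e. [s] acts on the first letter and [gs x] on the words below it. *)
Definition wreath_decomposition (g : tree_aut) (gs : 'I_d -> tree_aut)
    (s : {perm 'I_d}) : Prop :=
  forall x w, val g (x :: w) = s x :: val (gs x) w.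

(* Families of automorphisms defined by a wreath recursion
   [g_q = (g_(next q 1), ..., g_(next q d)) (perm q)]. *)
Section Automaton.
Variables (Q : Type) (out : Q -> {perm 'I_d}) (next : Q -> 'I_d -> Q).

Fixpoint run q w : seq 'I_d :=
  if w is x :: w' then out q x :: run (next q x) w' else [::].

Fixpoint run_inv q w : seq 'I_d :=
  if w is y :: w' then
    let x := ((out q)^-1)%g y in x :: run_inv (next q x) w'
  else [::].

Fact runK q : cancel (run q) (run_inv q).
Proof. by move=> w; elim: w q => //= x w IH q; rewrite permK IH. Qed.

Fact run_invK q : cancel (run_inv q) (run q).
Proof. by move=> w; elim: w q => //= x w IH q; rewrite permKV IH. Qed.

Definition run_bij q : bijection (seq 'I_d) := Bijection (runK q) (run_invK q).

Fact run_rcons q w x : exists y, run q (rcons w x) = rcons (run q w) y.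
Proof.
elim: w q => [|z w IH] q /=; first by exists (out q x).
by have [y ->] := IH (next q z); exists y.
Qed.

Fact run_inv_rcons q w x : exists y, run_inv q (rcons w x) = rcons (run_inv q w) y.
Proof.
elim: w q => [|z w IH] q /=; first by exists (((out q)^-1)%g x).
by have [y ->] := IH (next q (((out q)^-1)%g z)); exists y.
Qed.

Fact run_tree_aut q : run_bij q \in subgroup_set tree_aut.
Proof.
apply/mem_set; split=> // u v; split=> -[x].
  case=> -> /=; first by have [y ->] := run_rcons q u x; exists y; left.
  by have [y ->] := run_rcons q v x; exists y; right.
case=> /(congr1 (run_inv q)); rewrite /= runK => ->.
  by have [y ->] := run_inv_rcons q (run q u) x; exists y; left; rewrite runK.
by have [y ->] := run_inv_rcons q (run q v) x; exists y; right; rewrite runK.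
Qed.

Definition automaton q : tree_aut := exist _ (run_bij q) (run_tree_aut q).

Lemma automaton_decomposition q :
  wreath_decomposition (automaton q) (fun x => automaton (next q x)) (out q).
Proof. by []. Qed.

End Automaton.
End Tree.

Variant basilica_state := BasilicaId | BasilicaA | BasilicaB.

Definition basilica_out (q : basilica_state) : {perm 'I_2} :=
  if q is BasilicaB then tperm ord0 ord_max else 1.

Definition basilica_next (q : basilica_state) (x : 'I_2) : basilica_state :=
  if x == ord0 then BasilicaId else
  match q with
  | BasilicaId => BasilicaId
  | BasilicaA => BasilicaB
  | BasilicaB => BasilicaA
  end.

Definition basilica_a : tree_aut 2 :=
  automaton basilica_out basilica_next BasilicaA.
Definition basilica_b : tree_aut 2 :=
  automaton basilica_out basilica_next BasilicaB.

Definition basilica : subgroup (tree_aut 2) :=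
  generated [set basilica_a; basilica_b].

(* The Boolean state records whether the swap is still to be performed. *)
Definition hanoi_out m (i j : 'I_m) (q : bool) : {perm 'I_m} :=
  if q then tperm i j else 1.

Definition hanoi_next m (i j : 'I_m) (q : bool) (x : 'I_m) : bool :=
  [&& q, x != i & x != j].

Definition hanoi_generator m (i j : 'I_m) : tree_aut m :=
  automaton (hanoi_out i j) (hanoi_next i j) true.

Definition hanoi m : subgroup (tree_aut m) :=
  generated [set g | exists i j : 'I_m, (i < j)%N /\ g = hanoi_generator i j].

Lemma basilica_idE : automaton basilica_out basilica_next BasilicaId = 1.
Proof.
apply: val_inj; apply: bijectionP; elim=> //= x w IH.
by rewrite perm1 /basilica_next if_same IH.
Qed.

(* a = (1, b) *)
Lemma basilica_aE : wreath_decomposition basilica_a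
  (fun x => if x == ord0 then 1 else basilica_b) 1.
Proof.
move=> x w; rewrite -basilica_idE automaton_decomposition.
by rewrite /basilica_next; case: (x == ord0).
Qed.

(* b = (1, a) sigma *)
Lemma basilica_bE : wreath_decomposition basilica_b
  (fun x => if x == ord0 then 1 else basilica_a) (tperm ord0 ord_max).
Proof.
move=> x w; rewrite -basilica_idE automaton_decomposition.
by rewrite /basilica_next; case: (x == ord0).
Qed.

Lemma hanoi_generatorE m (i j : 'I_m) : wreath_decomposition (hanoi_generator i j)
  (fun k => if (k == i) || (k == j) then 1 else hanoi_generator i j) (tperm i j).
Proof.
have idE : automaton (hanoi_out i j) (hanoi_next i j) false = 1.
  by apply: val_inj; apply: bijectionP; elim=> //= x w IH; rewrite perm1 IH.
move=> x w; rewrite -idE /hanoi_generator automaton_decomposition.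
by rewrite /hanoi_next -negb_or; case: (_ || _).
Qed.

(* Main.v *)
From HB Require Import structures.
From mathcomp Require Import all_boot perm.
From mathcomp Require Import boolp classical_sets topology cantor.
From mathcomp Require Import zify.
Require Import Defs.

Set Implicit Arguments.
Unset Strict Implicit.
Unset Printing Implicit Defensive.
Local Open Scope group_scope.

(** Thompson's group V has a commutation property that the Basilica group and
    the Hanoi Towers groups lack. The property, [power_commutation], reads: for
    every f there is N > 0 such that for all j > 0 some k > 0 makes
    [g^k, h^k] commute with f^N whenever g and h commute with f^(N j).
    It only speaks of multiplication, so it passes to subgroups.

    Why V has it ([thompsonV_power_commutation]). An element f of V acts on
    the points w000... like a machine rewriting the top of a stack. Looking
    at the times after which the stack never gets lower, two of them show the
    same top u; hence, for a suitable N uniform in the point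
    ([orbit_alternative]), either f^N fixes the point, or its f-orbit enters a
    cylinder [u] on which f^N acts as u eta -> u w eta with w nonempty, so
    that it is attracted to u w w w ... Call a fixed point of F = f^(N j)
    singular if F is not the identity near it. There are finitely many singular
    points, since a rewriting rule u eta -> v eta with u different from v has
    at most one fixed point; the centralizer of F permutes them, so fixed
    powers g^k, h^k of elements of the centralizer fix them all. In V the germs
    of homeomorphisms fixing a given point commute ([germ_shift]: such a germ
    only shifts the length of the prefix), so c = [g^k, h^k] is trivial near the
    singular points. As c commutes with F and every point w000... moved by f^N is
    attracted to a singular point, c is trivial on the support of f^N, and
    therefore commutes with f^N. Restricting to the points w000... is harmless
    because they are dense.

    Why the tree groups lack it ([not_power_commutation]). Each of them
    contains an element f whose support shrinks under powers: for every N some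
    vertex v is moved by f^N although f^(2 N) is the identity below v. Then
    everything acting only below v commutes with f^(2 N), and nothing
    nontrivial acting only below v commutes with f^N. So it is enough to find
    g and h acting below v with [g^k, h^k] nontrivial, which exist as soon as
    the derived subgroup is closed under letting an element act below a given
    letter ([derived_branching]) and contains an element y of infinite order:
    if y^k moves w, the k-th powers of y and of y acting below w do not commute.

    For Basilica take f = a and y = [a, b]. For the Hanoi group on three pegs
    take f the product of the three generators, whose square has sections of
    the same shape on two subtrees and is trivial on the third, and y the
    commutator of two generators. The group on three pegs embeds in the group on
    m >= 3 pegs by ignoring the additional letters ([hanoi3_embeds]). *)

(** * Pigeonhole and arithmetic preliminaries *)

Lemma recurrent_color (I : finType) (P : nat -> Prop) (c : nat -> I) :
    (forall t, exists2 n, (t <= n)%N & P n) ->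
  exists n n', [/\ (n < n')%N, P n, P n' & c n = c n'].
Proof.
move=> infP; apply: contrapT => none.
have /boolp.choice[b bP] : forall i, exists b, forall n, P n -> c n = i -> (n <= b)%N.
  move=> i; have [[n [Pn cn]]|no] := pselect (exists n, P n /\ c n = i).
    exists n => n' Pn' cn'; rewrite leqNgt; apply/negP => nn'.
    by apply: none; exists n, n'; rewrite cn cn'.
  by exists 0%N => n Pn cn; case: no; exists n.
have [n nb Pn] := infP (\max_i b i).+1.
have := bP _ n Pn erefl; rewrite leqNgt (leq_trans _ nb) // ltnS.
exact: leq_bigmax.
Qed.

Lemma even_or_odd N : (exists m, N = 2 * m)%N \/ exists m, N = (2 * m).+1.
Proof.
rewrite -(odd_double_half N) -mul2n.
by case: (odd N); [right|left]; exists N./2.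
Qed.

Lemma last_minimum (h : nat -> nat) t :
  exists2 n, (t <= n)%N & forall m, (n <= m)%N -> (h n <= h m)%N.
Proof.
have ex : exists v, `[< exists2 n, (t <= n)%N & h n = v >].
  by exists (h t); apply/asboolP; exists t.
case: (ex_minnP ex) => v /asboolP[n tn <-] min; exists n => // m nm.
by apply: min; apply/asboolP; exists m; rewrite // (leq_trans tn nm).
Qed.

(** A single exponent serves finitely many properties stable under multiples:
    this is how the exponent N is made uniform in the points. *)
Lemma common_multiple (I : finType) (Q : I -> nat -> Prop) :
    (forall i m c, (0 < c)%N -> Q i m -> Q i (m * c)%N) ->
  exists2 N, (0 < N)%N & forall i m, (0 < m)%N -> Q i m -> Q i N.
Proof.
move=> Qmul.
have /boolp.choice[M MP] : forall i, exists M, (0 < M)%N /\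
    forall m, (0 < m)%N -> Q i m -> Q i M.
  move=> i; have [[m [m0 Qm]]|no] := pselect (exists m, (0 < m)%N /\ Q i m).
    by exists m.
  by exists 1%N; split=> // m m0 Qm; case: no; exists m.
exists (\prod_i M i)%N; first by apply: prodn_gt0 => i; have [] := MP i.
move=> i m m0 Qm; rewrite (bigD1 i) //=; apply: Qmul.
  by apply: prodn_gt0 => j; have [] := MP j.
by have [_] := MP i; apply; eassumption.
Qed.

(** * Prefixes and points ending in zeros *)

Lemma mkseqD (p : cantor_space) m n :
  mkseq p (m + n) = mkseq p m ++ mkseq (drop_seq m p) n.
Proof.
apply: (@eq_from_nth _ false); rewrite ?size_cat !size_mkseq // => i imn.
rewrite nth_cat size_mkseq nth_mkseq //; case: ltnP => im; rewrite nth_mkseq //.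
  by rewrite /drop_seq subnKC.
by lia.
Qed.

Lemma prependE u eta i :
  prepend u eta i = if (i < size u)%N then nth false u i else eta (i - size u)%N.
Proof. by []. Qed.

Lemma prepend_mkseq (p : cantor_space) n eta i :
  (i < n)%N -> prepend (mkseq p n) eta i = p i.
Proof. by move=> ip; rewrite prependE size_mkseq ip nth_mkseq. Qed.

Lemma mkseq_prependD u (eta : cantor_space) n :
  mkseq (prepend u eta) (size u + n) = u ++ mkseq eta n.
Proof.
rewrite mkseqD mkseq_prepend; congr (_ ++ _); apply: eq_mkseq => i.
by rewrite /drop_seq prependE ltnNge leq_addr /= addKn.
Qed.

Definition ends (n : nat) (x : cantor_space) := forall i, (n <= i)%N -> x i = false.

(** Length of the shortest word w with x = w000...: the height of the stack in
    the description of an orbit as a rewriting process. *)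
Definition height (x : cantor_space) : nat :=
  if pselect (exists n, `[< ends n x >]) is left e then ex_minn e else 0%N.

Definition terminating x := exists n, ends n x.

Lemma ends_leq m n x : (m <= n)%N -> ends m x -> ends n x.
Proof. by move=> mn mx i ni; apply: mx; exact: leq_trans mn ni. Qed.

Lemma ends_prepend u eta n : ends (size u + n) (prepend u eta) <-> ends n eta.
Proof.
split=> E i ni.
  have := E (size u + i)%N; rewrite leq_add2l => /(_ ni).
  by rewrite prependE ltnNge leq_addr /= addKn.
rewrite prependE ltnNge (leq_trans (leq_addr n _)) //=; apply: E; lia.
Qed.

Lemma ends_height x : terminating x -> ends (height x) x.
Proof.
move=> [n nx]; rewrite /height; case: pselect => [e|[]].
  by case: ex_minnP => m /asboolP.
by exists n; apply/asboolP.
Qed.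

Lemma height_min x n : ends n x -> (height x <= n)%N.
Proof.
move=> nx; rewrite /height; case: pselect => [e|//].
by case: ex_minnP => m _; apply; apply/asboolP.
Qed.

Lemma terminating_prepend u eta :
  terminating (prepend u eta) <-> terminating eta.
Proof.
split=> -[n nx]; last by exists (size u + n)%N; apply/ends_prepend.
by exists n; have [+ _] := ends_prepend u eta n; apply; apply: ends_leq nx;
  exact: leq_addl.
Qed.

(** This fails for eta = 000..., since then u itself may end in zeros. *)
Lemma height_prepend u eta : terminating eta -> (0 < height eta)%N ->
  height (prepend u eta) = (size u + height eta)%N.
Proof.
move=> te h0; apply/eqP; rewrite eqn_leq.
rewrite height_min /=; last by apply/ends_prepend; exact: ends_height.
set m := height (prepend _ _).
have : ends (m - size u) eta.
  apply/(ends_prepend u); apply: (@ends_leq m); first by lia.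
  by apply: ends_height; apply/terminating_prepend.
by move/height_min; lia.
Qed.

Lemma height_tail u eta : (size u < height (prepend u eta))%N -> (0 < height eta)%N.
Proof.
move=> uh; have [te|nt] := pselect (terminating eta); last first.
  case: nt; apply/(terminating_prepend u); move: uh; rewrite /height.
  by case: pselect => // e _; have [n /asboolP nx] := e; exists n.
rewrite lt0n; apply: contraTN uh => /eqP h0; rewrite -leqNgt.
apply: height_min; rewrite -(addn0 (size u)); apply/ends_prepend.
by rewrite -h0; apply: ends_height.
Qed.

Definition zeros : cantor_space := fun=> false.

Lemma low_point x n : terminating x -> (height x <= n)%N ->
  x = prepend (mkseq x n) zeros.
Proof.
move=> tx hn; apply/funext => i; rewrite prependE size_mkseq.
case: ltnP => ni; first by rewrite nth_mkseq.
by apply: (ends_height tx); exact: leq_trans hn ni.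
Qed.

(** * The action of Thompson's group on the Cantor set *)

Definition act (f : thompsonV) : cantor_space -> cantor_space := bij_fun (val f).

Lemma actM f g x : act (f * g) x = act f (act g x). Proof. by []. Qed.
Lemma actK f : cancel (act f) (act f^-1).
Proof. by move=> x; rewrite -actM mulVg. Qed.
Lemma act_inj f : injective (act f). Proof. exact: can_inj (actK f). Qed.
Lemma act_ext f g : act f =1 act g -> f = g.
Proof. by move=> fg; apply: val_inj; exact: bijectionP. Qed.

Lemma act_fixX f x n : act f x = x -> act (f ^+ n) x = x.
Proof. by move=> fx; elim: n => // n IH; rewrite expgS actM IH. Qed.

Lemma act_local f : exists k, local_prefix (act f) k.
Proof.
have /set_mem[_ [m [a [b [[_ aT] _ fab]]]]] := valP f.
exact: local_prefix_table aT fab.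
Qed.

Lemma local_prefix_at f k u : local_prefix f k -> (k <= size u)%N ->
  exists2 v, (size u - k <= size v)%N &
    forall eta, f (prepend u eta) = prepend v eta.
Proof. by move=> fk ku; apply: fk; rewrite subnK. Qed.

Lemma act_terminating f x : terminating x -> terminating (act f x).
Proof.
have [k fk] := act_local f; rewrite -[x](prefixK k) => /terminating_prepend tx.
have [|v _ ->] := local_prefix_at fk (_ : k <= size (mkseq x k))%N.
  by rewrite size_mkseq.
exact/terminating_prepend.
Qed.

(** Continuity, in terms of prefixes. *)
Lemma act_near f p n : exists m, forall eta,
  exists eta', act f (prepend (mkseq p m) eta) = prepend (mkseq (act f p) n) eta'.
Proof.
have [k fk] := act_local f; exists (n + k)%N.
have [|v nv fv] := fk n (mkseq p (n + k)); first by rewrite size_mkseq.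
have -> : mkseq (act f p) n = take n v.
  rewrite -[p](prefixK (n + k)) fv; apply: (@eq_from_nth _ false).
    by rewrite size_mkseq size_takel.
  rewrite size_mkseq => i ni.
  by rewrite nth_mkseq // nth_take // prependE (leq_trans ni nv).
move=> eta; exists (prepend (drop n v) eta).
by rewrite fv -prepend_cat cat_take_drop.
Qed.

(** Points ending in zeros are dense, so that identities in V need only be
    checked on them. *)
Lemma act_dense f g : (forall x, terminating x -> act f x = act g x) -> f = g.
Proof.
move=> fg; apply: act_ext => x; apply/funext => i.
have [m fm] := act_near f x i.+1; have [m' gm] := act_near g x i.+1.
pose y := prepend (mkseq x (maxn m m')) zeros.
have near q : (q <= maxn m m')%N -> exists eta, y = prepend (mkseq x q) eta.
  move=> qm; rewrite /y -(subnKC qm) mkseqD prepend_cat.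
  by eexists; reflexivity.
have ty : terminating y by apply/terminating_prepend; exists 0%N.
have [e ye] := near m (leq_maxl _ _); have [e' ye'] := near m' (leq_maxr _ _).
have [z fz] := fm e; have [z' gz] := gm e'.
have := fg y ty; rewrite {1}ye fz ye' gz.
by move=> /(congr1 (fun s : cantor_space => s i)); rewrite !prepend_mkseq.
Qed.

(** * Orbits are eventually fixed or attracted *)

(** If the height never drops below its initial value, the tail eta is never
    read, so the first j steps rewrite the prefix u uniformly in the tail. *)
Lemma stay_prefix f k u eta : local_prefix (act f) k -> size u = k ->
    terminating eta -> (0 < height eta)%N ->
    (forall j, height (prepend u eta) <= height (act (f ^+ j) (prepend u eta)))%N ->
  forall j, exists2 w, (k <= size w)%N &
    forall xi, act (f ^+ j) (prepend u xi) = prepend w xi.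
Proof.
move=> fk su te h0 low; elim=> [|j [w kw fw]]; first by exists u; rewrite ?su.
have [w' _ fw'] := local_prefix_at fk kw.
have fjw xi : act (f ^+ j.+1) (prepend u xi) = prepend w' xi.
  by rewrite expgS actM fw fw'.
exists w' => //; have := low j.+1.
by rewrite fjw !height_prepend // su leq_add2r.
Qed.

Definition prefix_tuple k (x : cantor_space) : k.-tuple bool :=
  @Tuple k bool (mkseq x k) (introT eqP (size_mkseq x k)).

Lemma actD f m n x : act (f ^+ (m + n)) x = act (f ^+ m) (act (f ^+ n) x).
Proof. by rewrite expgnDr. Qed.

Lemma act_fix_later f n N x :
  act (f ^+ N) (act (f ^+ n) x) = act (f ^+ n) x -> act (f ^+ N) x = x.
Proof. by rewrite -actD addnC actD => /act_inj. Qed.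

Fixpoint pow_word (w : seq bool) i := if i is i'.+1 then w ++ pow_word w i' else [::].

Lemma size_pow_word w i : w <> [::] -> (i <= size (pow_word w i))%N.
Proof.
move=> w0; elim: i => // i IH /=; rewrite size_cat -add1n leq_add //.
by case: w w0 {IH}.
Qed.

Lemma act_pow_word f m u w i :
    (forall xi, act (f ^+ m) (prepend u xi) = prepend (u ++ w) xi) ->
  forall xi, act (f ^+ (m * i)) (prepend u xi) = prepend (u ++ pow_word w i) xi.
Proof.
move=> fw; elim: i => [|i IH] xi; first by rewrite muln0 cats0.
by rewrite mulnS actD IH prepend_cat fw /= catA [RHS]prepend_cat.
Qed.

(** Among the times after which the height never gets lower, two have the same
    k-prefix u and lie on the same side of height k. If the height is at most
    k, the point is determined by u and recurs. If it exceeds k, nothing below u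
    is read in between ([stay_prefix]), so that a power of f maps each u eta to
    u w eta; empty w means that the point recurs. *)
Lemma orbit_alternative f : exists2 N, (0 < N)%N &
  forall x, terminating x -> act (f ^+ N) x = x \/
    exists n u w, [/\ w <> [::], exists eta, act (f ^+ n) x = prepend u eta &
      forall xi, act (f ^+ N) (prepend u xi) = prepend (u ++ w) xi].
Proof.
have [k fk] := act_local f.
(* The second component tells whether the height exceeds k. *)
pose Q (c : k.-tuple bool * bool) m :=
  if c.2 then exists w, forall xi, act (f ^+ m) (prepend c.1 xi) = prepend (c.1 ++ w) xi
  else act (f ^+ m) (prepend c.1 zeros) = prepend c.1 zeros.
have [|N N0 NP] := @common_multiple _ Q.
  move=> [u [] m c _] /=; rewrite /Q /=.
    by move=> [w fw]; exists (pow_word w c); exact: act_pow_word.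
  by rewrite expgnA; exact: act_fixX.
exists N => // x tx.
pose h n := height (act (f ^+ n) x).
pose c n := (prefix_tuple k (act (f ^+ n) x), (k < h n)%N).
have [n [n' [nn' nlow _ [cn ch]]]] := recurrent_color c (last_minimum h).
set y := act (f ^+ n) x in cn *.
have ty : terminating y by exact: act_terminating.
have ny : act (f ^+ (n' - n)) y = act (f ^+ n') x by rewrite /y -actD subnK // ltnW.
case: (ltnP k (h n)) => hn.
- have hy : (0 < height (drop_seq k y))%N.
    by apply: (@height_tail (mkseq y k)); rewrite prefixK size_mkseq.
  have [||j|w kw fw] := @stay_prefix f k (mkseq y k) (drop_seq k y) fk _ _ hy _ (n' - n).
  + by rewrite size_mkseq.
  + by apply/(terminating_prepend (mkseq y k)); rewrite prefixK.
  + by rewrite prefixK /y -actD; apply: nlow; exact: leq_addl.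
  have [w' fw'] : Q (prefix_tuple k y, true) N.
    apply: (NP _ (n' - n)%N); first by rewrite subn_gt0.
    exists (drop k w) => xi; rewrite fw; congr prepend.
    rewrite /= -[LHS](cat_take_drop k); congr (_ ++ _).
    rewrite /= cn; rewrite -ny -[in RHS](prefixK k y) fw.
    rewrite -[w in RHS](cat_take_drop k) prepend_cat.
    by rewrite -[X in mkseq _ X](size_takel kw) mkseq_prepend.
  case: (eqVneq w' [::]) => [w0|/eqP w0].
    left; apply: (@act_fix_later f n); rewrite -/y -{1}[y](prefixK k).
    by rewrite fw' w0 cats0 prefixK.
  right; exists n, (mkseq y k), w'; split=> //.
  by exists (drop_seq k y); rewrite prefixK.
- left; apply: (@act_fix_later f n); rewrite -/y.
  have yE : y = prepend (mkseq y k) zeros by exact: low_point.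
  have Qy m : Q (prefix_tuple k y, false) m <-> act (f ^+ m) y = y.
    by rewrite /Q /= -yE.
  apply/Qy; apply: (NP _ (n' - n)%N); first by rewrite subn_gt0.
  apply/Qy; rewrite ny yE cn; apply: low_point; first exact: act_terminating.
  by rewrite leqNgt -/(h n') -ch -leqNgt.
Qed.

(** * Germs at singular points *)

Definition fixes_near (g : thompsonV) (p : cantor_space) := exists n,
  forall eta, act g (prepend (mkseq p n) eta) = prepend (mkseq p n) eta.

(** Fixed points at which the germ of g is nontrivial: those that attract or
    repel. *)
Definition singular (g : thompsonV) (p : cantor_space) :=
  act g p = p /\ ~ fixes_near g p.

Lemma fixes_near_conj c q p : fixes_near c (act q p) -> fixes_near (c ^ q) p.
Proof.
move=> [n cn]; have [m qm] := act_near q p n; exists m => eta.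
by have [z qz] := qm eta; rewrite !actM qz cn -qz actK.
Qed.

Lemma periodic_unique w x y : w <> [::] ->
  prepend w x = x -> prepend w y = y -> x = y.
Proof.
move=> w0 wx wy; apply/funext => i; elim/ltn_ind: i => i IH.
rewrite -wx -wy !prependE; case: ltnP => // wi; apply: IH.
by case: w w0 wi {wx wy} => //= a s _; lia.
Qed.

(** Near p, g replaces the k-prefix u by a word v different from u. If v = u w
    then the tail of p satisfies x = w x, and if u = v w likewise, which
    determines p. *)
Lemma singular_prefix g k p q : local_prefix (act g) k ->
  singular g p -> singular g q -> mkseq p k = mkseq q k -> p = q.
Proof.
move=> gk [gp sp] [gq _] pq.
have [|v _ gv] := local_prefix_at gk (_ : k <= size (mkseq p k))%N.
  by rewrite size_mkseq.
have := prefixK k q; rewrite -pq; have := prefixK k p.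
set u := mkseq p k in gv *; set x := drop_seq k p; set y := drop_seq k q => px qy.
have vx : prepend v x = prepend u x by rewrite -gv px.
have vy : prepend v y = prepend u y by rewrite -gv qy.
suff xy : x = y by rewrite -px -qy xy.
case: (ltngtP (size u) (size v)) => uv.
- have vE := prepend_split (ltnW uv) (esym vx).
  apply: (@periodic_unique (drop (size u) v)).
  + by move/(congr1 size); rewrite size_drop /=; lia.
  + by apply: (@prepend_inj u); rewrite -prepend_cat -vE.
  + by apply: (@prepend_inj u); rewrite -prepend_cat -vE.
- have uE := prepend_split (ltnW uv) vx.
  apply: (@periodic_unique (drop (size v) u)).
  + by move/(congr1 size); rewrite size_drop /=; lia.
  + by apply: (@prepend_inj v); rewrite -prepend_cat -uE.
  + by apply: (@prepend_inj v); rewrite -prepend_cat -uE.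
- case: sp; exists k => eta.
  by rewrite -/u gv (prepend_inj_size uv (esym vx)).
Qed.

Lemma singular_commute g F p : commute g F -> singular F p -> singular F (act g p).
Proof.
move=> gF [Fp sp]; split; first by rewrite -actM -gF actM Fp.
move=> near; apply: sp; suff <- : F ^ g = F by exact: fixes_near_conj.
by rewrite conjgE -gF mulKg.
Qed.

(** The centralizer of F permutes the singular points of F, of which there are
    at most 2^k, so the orbit of p under g closes up after at most 2^k steps. *)
Lemma singular_fixed_power F k g p : local_prefix (act F) k -> commute g F ->
  singular F p -> act (g ^+ (2 ^ k)`!) p = p.
Proof.
move=> Fk gF sp.
have sgp i : singular F (act (g ^+ i) p).
  apply: singular_commute => //; apply/esym; exact: commuteX.
pose c (i : 'I_(2 ^ k).+1) := prefix_tuple k (act (g ^+ i) p).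
have /injectivePn[i [j ij cij]] : ~~ injectiveb c.
  apply/negP => /injectiveP /leq_card.
  by rewrite card_ord card_tuple card_bool ltnn.
wlog {ij} ij : i j cij / (i < j)%N => [H|].
  have [lt|gt|eq] := ltngtP i j; [exact: (H i j)|exact: (H j i)|].
  by rewrite (val_inj eq) eqxx in ij.
have := singular_prefix Fk (sgp i) (sgp j) (congr1 val cij).
rewrite -(subnK (ltnW ij)) actD => E.
have fixm : act (g ^+ (j - i)) p = p by exact: act_fix_later (esym E).
have /dvdnP[q ->] : (j - i %| (2 ^ k)`!)%N.
  by apply: dvdn_fact; rewrite subn_gt0 ij leq_subLR (leq_trans (leq_ord j)) ?leq_addl.
by rewrite mulnC expgnA; exact: act_fixX.
Qed.

(** The germ of g at a fixed point only lengthens or shortens the prefix of p,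
    so it is determined by an integer; this is why germs at p commute. *)
Lemma germ_shift g p : act g p = p -> exists s t, forall n eta,
  act g (prepend (mkseq p (s + n)) eta) = prepend (mkseq p (t + n)) eta.
Proof.
move=> gp; have [k gk] := act_local g.
have [|v _ gv] := local_prefix_at gk (_ : k <= size (mkseq p k))%N.
  by rewrite size_mkseq.
have pv : p = prepend v (drop_seq k p) by rewrite -gv prefixK.
exists k, (size v) => n eta; rewrite mkseqD prepend_cat gv -prepend_cat.
by rewrite [in RHS]pv mkseq_prependD.
Qed.

Lemma commutator_fixes_near g h p : act g p = p -> act h p = p ->
  fixes_near [~ g, h] p.
Proof.
move=> /germ_shift[s [t gst]] /germ_shift[s' [t' hst]]; exists (s + s')%N => eta.
have gh : act g (act h (prepend (mkseq p (s + s')) eta)) =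
          act h (act g (prepend (mkseq p (s + s')) eta)).
  rewrite gst [(t + s')%N]addnC [(s + s')%N]addnC !hst.
  by rewrite [(t' + s)%N]addnC gst; congr (prepend (mkseq p _) eta); lia.
by rewrite commgEl conjgE !actM gh !actK.
Qed.

(** The periodic point www... *)
Definition word_power (w : seq bool) : cantor_space :=
  fun i => nth false w (i %% size w).

Lemma prepend_word_power w : prepend w (word_power w) = word_power w.
Proof.
apply/funext => i; rewrite prependE /word_power; case: ltnP => wi.
  by rewrite modn_small.
by rewrite -{2}(subnK wi) modnDr.
Qed.

Lemma prepend_pow_word w i :
  prepend (pow_word w i) (word_power w) = word_power w.
Proof.
elim: i => [|i IH] /=; last by rewrite prepend_cat IH prepend_word_power.
by apply/funext => l; rewrite prependE subn0.
Qed.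

Section Attracting.
Variables (F : thompsonV) (u w : seq bool).
Hypothesis w_neq0 : w <> [::].
Hypothesis Fuw : forall xi, act F (prepend u xi) = prepend (u ++ w) xi.

Let p := prepend u (word_power w).

Lemma attracting_limit n i xi : (n <= i)%N ->
  mkseq (act (F ^+ i) (prepend u xi)) n = mkseq p n.
Proof.
move=> ni; rewrite -(mul1n i) (@act_pow_word F 1 u w) //.
rewrite /p -(prepend_pow_word w i) -prepend_cat.
apply: (@eq_from_nth _ false); rewrite !size_mkseq // => l ln.
have lw : (l < size (u ++ pow_word w i))%N.
  by rewrite size_cat; have := size_pow_word i w_neq0; lia.
by rewrite !nth_mkseq // !prependE lw.
Qed.

(** Were F the identity near p, the points near p other than p would be both
    fixed by F and attracted to p. *)
Lemma attracting_singular : singular F p.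
Proof.
split; first by rewrite /p Fuw prepend_cat prepend_word_power.
move=> [n Fn].
pose y := prepend (mkseq p (size u + n)) (fun=> ~~ p (size u + n)%N).
have yu : exists xi, y = prepend u xi.
  rewrite /y mkseqD prepend_cat mkseq_prepend; by eexists.
have yF : act F y = y.
  rewrite /y addnC mkseqD prepend_cat; exact: Fn.
suff : y = p.
  move/(congr1 (fun x : cantor_space => x (size u + n)%N)).
  by rewrite /y prependE size_mkseq ltnn; case: (p _).
apply/funext => i; have [xi yxi] := yu.
have /(congr1 (nth false ^~ i)) := attracting_limit xi (leqnn i.+1).
by rewrite -yxi act_fixX // !nth_mkseq.
Qed.

End Attracting.

Lemma commute_actE f g x : commute f g -> act f (act g x) = act g (act f x).
Proof. by move=> fg; rewrite -!actM fg. Qed.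

(** Let p be the limit of the F-orbit of f^n x. Then f^(-n) p is singular as
    well, so c is trivial near it and fixes F^m x for large m, up to the
    conjugation by f^n; since c commutes with F, it fixes x. *)
Lemma trivial_on_attracted c f n N j x u w xi : w <> [::] ->
    commute c (f ^+ (N * j)) -> (0 < j)%N ->
    (forall p, singular (f ^+ (N * j)) p -> fixes_near c p) ->
    act (f ^+ n) x = prepend u xi ->
    (forall eta, act (f ^+ N) (prepend u eta) = prepend (u ++ w) eta) ->
  act c x = x.
Proof.
move=> w0 cF j0 cP xu fu; set F := f ^+ (N * j) in cF cP.
have FW eta : act F (prepend u eta) = prepend (u ++ pow_word w j) eta.
  exact: act_pow_word.
have W0 : pow_word w j <> [::].
  by move=> W; have := size_pow_word j w0; rewrite W; case: (j) j0.
set p := prepend u (word_power (pow_word w j)).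
have fF : commute (f ^+ n) F by exact: commuteX2.
have /cP : singular F (act (f ^+ n)^-1 p).
  apply: singular_commute; last exact: attracting_singular.
  by apply/esym/commuteV/esym.
move=> /fixes_near_conj[m cm].
have : act (c ^ (f ^+ n)^-1) (act (F ^+ m) (act (f ^+ n) x)) =
       act (F ^+ m) (act (f ^+ n) x).
  by rewrite xu -(prefixK m (act (F ^+ m) _)) (attracting_limit W0 FW) //; exact: cm.
rewrite conjgE invgK !actM -(commute_actE x (commuteX m fF)) actK => /act_inj.
by rewrite (commute_actE x (commuteX m cF)) => /act_inj.
Qed.

(** * The commutation property of powers *)

Definition power_commutation (G : groupType) := forall f : G, exists2 N, (0 < N)%N &
  forall j, (0 < j)%N -> exists2 k, (0 < k)%N &
  forall g h, commute g (f ^+ (N * j)) -> commute h (f ^+ (N * j)) ->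
  commute [~ g ^+ k, h ^+ k] (f ^+ N).

Theorem thompsonV_power_commutation : power_commutation thompsonV.
Proof.
move=> f; have [N N0 alt] := orbit_alternative f; exists N => // j j0.
have [k Fk] := act_local (f ^+ (N * j)).
exists (2 ^ k)`!; first exact: fact_gt0.
move=> g h gF hF; set c := [~ _, _].
have cF : commute c (f ^+ (N * j)).
  have gk := commuteX (2 ^ k)`! (esym gF); have hk := commuteX (2 ^ k)`! (esym hF).
  apply/esym; rewrite /c commgEl conjgE.
  by do ![apply: commuteM => // | apply: commuteV => //].
have cP p : singular (f ^+ (N * j)) p -> fixes_near c p.
  by move=> sp; apply: commutator_fixes_near; apply: singular_fixed_power Fk _ sp.
clearbody c.
have dich x : terminating x -> act (f ^+ N) x = x \/ act c x = x.
  move=> tx; have [|[n [u [w [w0 [xi xu] fu]]]]] := alt x tx; first by left.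
  by right; apply: (trivial_on_attracted w0 cF j0 cP xu fu).
apply: act_dense => x tx; rewrite !actM.
(* Apply the alternative to x, then to its image under the map that moves it. *)
case: (dich x tx) => [fx|cx]; [rewrite fx|rewrite cx].
- have [||/act_inj cx] := dich (act c x); first exact: act_terminating.
    by move=> ->.
  by rewrite cx fx.
- have [|/act_inj fx|] := dich (act (f ^+ N) x); first exact: act_terminating.
    by rewrite fx cx.
  by move=> ->.
Qed.

Lemma power_commutation_embeds (G H : groupType) :
  embeds G H -> power_commutation H -> power_commutation G.
Proof.
move=> [phi0 phi_inj] EH f.
have phi1 : phi0 1 = 1 by apply: (@mulgI _ (phi0 1)); rewrite -gmulfM !mulg1.
pose phi : UMagmaMorphism.type G H :=
  HB.pack (Multiplicative.sort phi0)
    (Multiplicative_isUMagmaMorphism.Build G H phi0 phi1).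
have [N N0 jP] := EH (phi f); exists N => // j j0.
have [k k0 ghP] := jP j j0; exists k => // g h gf hf.
have phiC x y : commute x y <-> commute (phi x) (phi y).
  by split=> [/gmulf_commute //|]; rewrite /commute -!gmulfM => /phi_inj.
apply/phiC; rewrite gmulfR !gmulfXn; apply: ghP; rewrite -gmulfXn; exact/phiC.
Qed.

Lemma embeds_trans (G H K : groupType) : embeds G H -> embeds H K -> embeds G K.
Proof.
move=> [phi phi_inj] [psi psi_inj].
by exists (psi \o phi : {multiplicative G -> K}); exact: inj_comp.
Qed.

(** * Branching over the derived subgroup *)

Section Branching.
Variable G : groupType.
Implicit Types (H S P : G -> Prop) (x y z : G).

Definition is_subgroup P :=
  [/\ P 1, forall x y, P x -> P y -> P (x * y) & forall x, P x -> P x^-1].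

Lemma subgroup_conj P x z : is_subgroup P -> P x -> P z -> P (x ^ z).
Proof.
by move=> [_ PM PV] Px Pz; rewrite conjgE; apply: (PM); [exact: PV|exact: PM].
Qed.

Lemma subgroup_commutator P x y : is_subgroup P -> P x -> P y -> P [~ x, y].
Proof.
move=> sP Px Py; have [_ PM PV] := sP; rewrite commgEl.
by apply: (PM); [exact: PV|exact: subgroup_conj].
Qed.

Lemma subgroup_exp P x n : is_subgroup P -> P x -> P (x ^+ n).
Proof.
by move=> [P1 PM _] Px; elim: n => [//|n IH]; rewrite expgS; exact: PM.
Qed.

(** The inverse of a commutator is a commutator, so products suffice to
    describe the derived subgroup. *)
Inductive derived H : G -> Prop :=
| derived_commutator x y : H x -> H y -> derived H [~ x, y]
| derived_mul x y : derived H x -> derived H y -> derived H (x * y).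

Variables H S : G -> Prop.
Hypothesis subH : is_subgroup H.

Lemma derived_sub x : derived H x -> H x.
Proof.
have [_ HM _] := subH; elim=> [{}x y Hx Hy|{}x y _ Hx _ Hy]; last exact: HM.
exact: subgroup_commutator.
Qed.

Lemma derived_inv x : derived H x -> derived H x^-1.
Proof.
elim=> [{}x y Hx Hy|{}x y _ Dx _ Dy]; first by rewrite invgR; constructor.
by rewrite invgM; exact: derived_mul.
Qed.

Lemma derived_conj x z : H z -> derived H x -> derived H (x ^ z).
Proof.
move=> Hz; elim=> [{}x y Hx Hy|{}x y _ Dx _ Dy]; last by rewrite conjMg; exact: derived_mul.
by rewrite conjRg; constructor; exact: subgroup_conj.
Qed.

Hypothesis genH : forall P, is_subgroup P -> (forall s, S s -> P s) ->
  forall x, H x -> P x.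
Hypothesis SH : forall s, S s -> H s.

Variable delta : UMagmaMorphism.type G G.
Hypothesis lift : forall s, S s -> exists2 t, H t &
  forall x, delta x ^ t = delta (x ^ s).
Hypothesis delta_commutator : forall s t, S s -> S t ->
  derived H (delta [~ s, t]).

(** The normal subgroup derived H pulls back along delta to a subgroup that is
    normalized by H, since conjugation by H lifts through delta. *)
Lemma derived_delta_conj x z : H z -> derived H (delta x) -> derived H (delta (x ^ z)).
Proof.
have [H1 HM HV] := subH.
move=> Hz Dx; suff [t Ht <-] : exists2 t, H t & forall x, delta x ^ t = delta (x ^ z).
  exact: derived_conj.
elim/genH: Hz => //; split.
- by exists 1 => // y; rewrite !conjg1.
- move=> s s' [t Ht tE] [t' Ht' tE']; exists (t * t'); first exact: HM.
  by move=> y; rewrite !conjgM tE tE'.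
- move=> s [t Ht tE]; exists t^-1; first exact: HV.
  by move=> y; rewrite -{1}(conjgKV s y) -tE conjgK.
Qed.

(** Commutators with a product or an inverse expand into conjugates of
    commutators with the factors, so only generators need be checked. *)
Lemma derived_delta_commutator x :
  H x -> (forall s, S s -> derived H (delta [~ x, s])) ->
  forall y, H y -> derived H (delta [~ x, y]).
Proof.
have [H1 HM HV] := subH.
move=> Hx Dx y Hy; suff [] : H y /\ derived H (delta [~ x, y]) by [].
elim/genH: Hy; last by move=> s Ss; split; [exact: SH|exact: Dx].
split.
- split=> //; rewrite commg1 gmulf1 -(commg1 1); exact: derived_commutator.
- move=> z z' [Hz Dz] [Hz' Dz']; split; first exact: HM.
  have -> : [~ x, z * z'] = [~ x, z'] * [~ x, z] ^ z'.
    by rewrite !commgEl !conjgE !gnorm.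
  by rewrite gmulfM; apply: derived_mul => //; exact: derived_delta_conj.
- move=> z [Hz Dz]; split; first exact: HV.
  have -> : [~ x, z^-1] = ([~ x, z] ^ z^-1)^-1.
    by rewrite !commgEl !conjgE !gnorm.
  by rewrite gmulfV; apply/derived_inv/derived_delta_conj => //; exact: HV.
Qed.

Lemma derived_delta_sym y z :
  derived H (delta [~ y, z]) -> derived H (delta [~ z, y]).
Proof. by move/derived_inv; rewrite -gmulfV invgR. Qed.

(** For delta the insertion of an element below a letter, this is the usual
    criterion for a self-similar group to be weakly regular branch over its
    derived subgroup. *)
Lemma derived_branching x : derived H x -> derived H (delta x).
Proof.
elim=> [{}x y Hx Hy|{}x y _ Dx _ Dy]; last by rewrite gmulfM; exact: derived_mul.
apply: derived_delta_commutator => // s Ss; apply: derived_delta_sym.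
apply: derived_delta_commutator => //; first exact: SH.
by move=> t St; exact: delta_commutator.
Qed.

End Branching.

(** * A criterion for groups of tree automorphisms *)

Section Tree.
Variable d : nat.
Notation Gamma := (bijection (seq 'I_d)).

(** The groups are types of nested pairs; this is the underlying set of
    bijections of the vertices, where insertions below a letter live. *)
Definition elements (G : subgroup (tree_aut d)) (b : Gamma) :=
  exists x : G, val (val x) = b.

Lemma elements_subgroup G : is_subgroup (elements G).
Proof.
split; first by exists 1.
- by move=> _ _ [x <-] [y <-]; exists (x * y).
- by move=> _ [x <-]; exists x^-1.
Qed.

Lemma elements_gen (S : set (tree_aut d)) s : S s -> elements (generated S) (val s).
Proof.
move=> Ss; have Gs : s \in subgroup_set (generated S).
  by apply/mem_set => P [_]; apply.
by exists (exist _ s Gs).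
Qed.

Lemma elements_ind (S : set (tree_aut d)) (P : Gamma -> Prop) :
  is_subgroup P -> (forall s, S s -> P (val s)) ->
  forall b, elements (generated S) b -> P b.
Proof.
move=> [P1 PM PV] PS b [[x Gx] <-] /=.
move/set_mem: Gx => /(_ (fun t => P (val t))); apply; split=> //.
by apply: group_closed_set => [|y z Py Pz|y Py] /=; [|exact: PM|exact: PV].
Qed.

Lemma tree_aut_cat (t : tree_aut d) w u : exists2 u', size u' = size u &
  val t (w ++ u) = val t w ++ u'.
Proof.
have /set_mem[t0 tE] := valP t.
have t_inj : injective (val t) := can_inj (bij_funK (val t)).
have t_rcons : forall s x, exists y, val t (rcons s x) = rcons (val t s) y.
  elim/last_ind => [x|s z IH x].
    have /tE[y [E|]] : tree_edge [::] (rcons [::] x) by exists x; left.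
      by exists y.
    by rewrite t0; case: (val t _).
  have /tE[y [E|]] : tree_edge (rcons s z) (rcons (rcons s z) x) by exists x; left.
    by exists y.
  have [z' ->] := IH z => /rcons_inj[/t_inj E _].
  by move/(congr1 size): E; rewrite !size_rcons; lia.
elim/last_ind: u => [|u x [u' su tu]]; first by exists [::]; rewrite ?cats0.
rewrite -rcons_cat; have [y ->] := t_rcons (w ++ u) x.
by exists (rcons u' y); rewrite ?size_rcons ?su // tu rcons_cat.
Qed.

Lemma tree_aut_size (t : tree_aut d) w : size (val t w) = size w.
Proof.
have /set_mem[t0 _] := valP t.
by have [u su] := tree_aut_cat t [::] w; rewrite t0 => ->.
Qed.

Definition below_fun (i : 'I_d) (g : seq 'I_d -> seq 'I_d) (s : seq 'I_d) :=
  if s is x :: w then x :: (if x == i then g w else w) else [::].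

Lemma below_funK i g g' : cancel g g' -> cancel (below_fun i g) (below_fun i g').
Proof. by move=> gK [//|x w] /=; case: eqP => // _; rewrite gK. Qed.

(** This is (1, ..., g, ..., 1), with g at the letter i. *)
Definition below (i : 'I_d) (g : Gamma) : Gamma :=
  Bijection (below_funK i (bij_funK g)) (below_funK i (bij_invK g)).

Lemma belowM i : {morph below i : g h / g * h}.
Proof.
by move=> g h; apply: bijectionP => -[//|x w] /=; rewrite /below_fun /=; case: eqP.
Qed.

Fact below1 i : below i 1 = 1.
Proof. by apply: bijectionP => -[//|x w] /=; rewrite /below_fun if_same. Qed.

HB.instance Definition _ i :=
  isUMagmaMorphism.Build Gamma Gamma (below i) (below1 i, @belowM i).

Definition below_word v g := foldr below g v.

Lemma below_wordM v : {morph below_word v : g h / g * h}.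
Proof. by move=> g h; elim: v => //= i v ->; rewrite belowM. Qed.

Fact below_word1 v : below_word v 1 = 1.
Proof. by elim: v => //= i v ->; rewrite below1. Qed.

HB.instance Definition _ v := isUMagmaMorphism.Build Gamma Gamma (below_word v)
  (below_word1 v, @below_wordM v).

Lemma below_word_cat v (g : Gamma) u : below_word v g (v ++ u) = v ++ g u.
Proof. by elim: v => //= i v IH; rewrite eqxx IH. Qed.

Lemma below_word_out v (g : Gamma) s : ~~ prefix v s -> below_word v g s = s.
Proof.
elim: v s => [|i v IH] [|x s] //=; rewrite eq_sym; case: eqP => //= _ ps.
by rewrite IH.
Qed.

Lemma below_word_commute_fix v (g f : Gamma) :
  (forall w, f (v ++ w) = v ++ w) -> commute (below_word v g) f.
Proof.
move=> fv; apply: bijectionP => s; rewrite !bij_mulE.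
have [/prefixP[w ->]|ps] := boolP (prefix v s).
  by rewrite fv below_word_cat fv.
rewrite (below_word_out _ ps) below_word_out //; apply: contra ps.
move=> /prefixP[w fs]; suff -> : s = v ++ w by rewrite prefix_prefix.
by apply: (can_inj (bij_funK f)); rewrite fv.
Qed.

(** An automorphism moving v carries the subtree below v to a disjoint one. *)
Lemma below_word_not_commute v (g : Gamma) (t : tree_aut d) :
  g <> 1 -> val t v <> v -> ~ commute (below_word v g) (val t).
Proof.
move=> g1 tv C; apply: g1; apply: bijectionP => u.
have /(congr1 (fun b : Gamma => b (v ++ u))) := C; rewrite !bij_mulE below_word_cat.
rewrite below_word_out.
  by move=> /(can_inj (bij_funK (val t))) /(congr1 (drop (size v))); rewrite !drop_size_cat.
have [u' _ ->] := tree_aut_cat t v u.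
apply/negP => /prefixP[z /(congr1 (take (size v)))].
by rewrite take_size_cat // take_size_cat ?tree_aut_size.
Qed.

Lemma elements_commute (G : subgroup (tree_aut d)) (x y : G) :
  commute x y <-> commute (val (val x)) (val (val y)).
Proof.
split=> C; first by rewrite /commute -!gmulfM C.
by do 2 apply: val_inj; rewrite !gmulfM.
Qed.

(** With j = 2, everything inserted below v commutes with f^(2 N), and insertions
    below v commute with f^N only if trivial. If y^k moves w, then y inserted
    below w and y itself have k-th powers that do not commute, and inserting both
    of them below v contradicts the property. *)
Lemma not_power_commutation (G : subgroup (tree_aut d)) (D : Gamma -> Prop)
    (f y : Gamma) :
    (forall b, D b -> elements G b) ->
    (forall i b, D b -> D (below i b)) ->
    D y -> (forall k, (0 < k)%N -> y ^+ k <> 1) ->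
    elements G f ->
    (forall N, (0 < N)%N -> exists2 v, (f ^+ N) v <> v &
       forall w, (f ^+ (N * 2)) (v ++ w) = v ++ w) ->
  ~ power_commutation G.
Proof.
move=> DG Dbelow Dy y_inf [F FE] shrink PC.
have [N N0 /(_ 2%N isT)[k k0 ghP]] := PC F.
have [v fv fv2] := shrink N N0.
have [Y YE] := DG _ Dy.
have Dword u b : D b -> D (below_word u b).
  by move=> Db; elim: u => //= i u; exact: Dbelow.
have [w yw] : exists w, (y ^+ k) w <> w.
  apply: contrapT => none; apply: (y_inf k k0); apply: bijectionP => w.
  by apply: contrapT => yw; apply: none; exists w.
have [g gE] := DG _ (Dword v _ (Dword w _ Dy)).
have [h hE] := DG _ (Dword v _ Dy).
have : commute [~ g ^+ k, h ^+ k] (F ^+ N).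
  by apply: ghP; apply/elements_commute; rewrite !gmulfXn /= FE ?gE ?hE;
    exact: below_word_commute_fix.
move=> /elements_commute; rewrite !gmulfR !gmulfXn /= gE hE -!gmulfXn -gmulfR.
rewrite -[sval (sval F)]/(val (val F)) FE.
have fE n : f ^+ n = val (val F ^+ n) by rewrite gmulfXn /= FE.
have yE n : y ^+ n = val (val Y ^+ n) by rewrite gmulfXn /= YE.
rewrite {1}fE; apply: below_word_not_commute; last by rewrite -fE.
move/eqP/commgP; rewrite {2}yE; apply: below_word_not_commute; first exact: y_inf.
by rewrite -yE.
Qed.

End Tree.

(** * Sections *)

Lemma conj_eq (G : groupType) (x y t : G) : x * t = t * y -> x ^ t = y.
Proof. by move=> E; rewrite conjgE E mulKg. Qed.

Lemma conj_app (T : Type) (x s : bijection T) z : s ((x ^ s) z) = x (s z).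
Proof. by rewrite conjgE -bij_mulE mulVKg. Qed.

Lemma below_in d (i : 'I_d) g w : below i g (i :: w) = i :: g w.
Proof. by rewrite /= eqxx. Qed.

Lemma below_out d (i x : 'I_d) g w : x != i -> below i g (x :: w) = x :: w.
Proof. by rewrite /=; case: eqP. Qed.

(** If t carries the subtree below j to that below i with section g, then
    conjugation by t carries elements supported below i to elements supported
    below j. *)
Lemma below_conj d (i j : 'I_d) (x t g : bijection (seq 'I_d)) :
  (forall w, t (j :: w) = i :: g w) -> below i x ^ t = below j (x ^ g).
Proof.
move=> tj; apply: conj_eq; apply: bijectionP => s; rewrite !bij_mulE.
have [[w ->]|out] := pselect (exists w, s = j :: w).
  by rewrite below_in !tj below_in conj_app.
have -> : below j (x ^ g) s = s.
  case: s out => // y w out; rewrite below_out //.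
  by apply/eqP => yj; apply: out; exists w; rewrite yj.
case ts : (t s) => [//|y w]; rewrite below_out //; apply/eqP => yi; apply: out.
exists (g^-1 w); apply: (can_inj (bij_funK t)).
by rewrite ts yi tj -bij_mulE mulgV.
Qed.

Lemma exp_section d (g h : bijection (seq 'I_d)) x n w :
  (forall w, g (x :: w) = x :: h w) -> (g ^+ n) (x :: w) = x :: (h ^+ n) w.
Proof.
by move=> gx; elim: n => // n IH; rewrite !expgS bij_mulE IH gx.
Qed.

(** * The Basilica group *)

Section Basilica.
Notation Gamma := (bijection (seq 'I_2)).
Let i0 : 'I_2 := ord0.
Let i1 : 'I_2 := ord_max.
Let a : Gamma := val basilica_a.
Let b : Gamma := val basilica_b.

Lemma ord2P (P : 'I_2 -> Prop) : P i0 -> P i1 -> forall x, P x.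
Proof.
move=> P0 P1 [[|[|n]] lt] //; [move: P0|move: P1]; congr P; exact: val_inj.
Qed.

Lemma basilica_a0 w : a (i0 :: w) = i0 :: w.
Proof. by rewrite /a basilica_aE perm1. Qed.

Lemma basilica_a1 w : a (i1 :: w) = i1 :: b w.
Proof. by rewrite /a basilica_aE perm1. Qed.

Lemma basilica_b0 w : b (i0 :: w) = i1 :: w.
Proof. by rewrite /b basilica_bE tpermL. Qed.

Lemma basilica_b1 w : b (i1 :: w) = i0 :: a w.
Proof. by rewrite /b basilica_bE tpermR. Qed.

Let abE := (basilica_a0, basilica_a1, basilica_b0, basilica_b1).

Lemma basilica_aX0 n w : (a ^+ n) (i0 :: w) = i0 :: w.
Proof. by elim: n => // n IH; rewrite expgS bij_mulE IH abE. Qed.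

Lemma basilica_aX1 n w : (a ^+ n) (i1 :: w) = i1 :: (b ^+ n) w.
Proof. by apply: exp_section => {}w; rewrite abE. Qed.

Lemma basilica_bb x w : b (b (x :: w)) = x :: a w.
Proof. by elim/ord2P: x; rewrite !abE. Qed.

(** This is b^2 = (a, a). *)
Lemma basilica_bX n x w : (b ^+ (2 * n)) (x :: w) = x :: (a ^+ n) w.
Proof.
by rewrite expgnA; apply: exp_section => {}w; exact: basilica_bb.
Qed.

Lemma basilica_bX_odd n w : (b ^+ (2 * n).+1) (i0 :: w) = i1 :: (a ^+ n) w.
Proof. by rewrite expgSr bij_mulE basilica_b0 basilica_bX. Qed.

Lemma basilica_b_order k : (0 < k)%N -> b ^+ k <> 1.
Proof.
elim/ltn_ind: k => k IH k0 bk.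
have [[m kE]|[m kE]] := even_or_odd k; last first.
  have := congr1 (fun g : Gamma => g [:: i0]) bk.
  by rewrite kE basilica_bX_odd.
apply: (IH m); [lia|lia|]; apply: bijectionP => w.
have := congr1 (fun g : Gamma => g [:: i1, i1 & w]) bk.
by rewrite kE basilica_bX basilica_aX1 => -[].
Qed.

(** For odd N, b^N exchanges the letters while b^(2 N) = (a^N, a^N) is trivial
    below 00 as a = (1, b). The even case reduces to N / 2, because b^(2 m) has
    section b^m at the vertex 11. *)
Lemma basilica_b_shrinks N : (0 < N)%N -> exists2 v, (b ^+ N) v <> v &
  forall w, (b ^+ (N * 2)) (v ++ w) = v ++ w.
Proof.
elim/ltn_ind: N => N IH N0; have [[m NE]|[m NE]] := even_or_odd N; last first.
  exists [:: i0; i0]; first by rewrite NE basilica_bX_odd.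
  by move=> w; rewrite mulnC basilica_bX /= basilica_aX0.
have [||v bv bv2] := IH m; [lia|lia|].
exists [:: i1, i1 & v]; first by rewrite NE basilica_bX basilica_aX1 => -[].
by move=> w; rewrite NE -mulnA basilica_bX /= basilica_aX1 bv2.
Qed.

Lemma basilica_a_shrinks N : (0 < N)%N -> exists2 v, (a ^+ N) v <> v &
  forall w, (a ^+ (N * 2)) (v ++ w) = v ++ w.
Proof.
move=> /basilica_b_shrinks[v bv bv2].
exists (i1 :: v); first by rewrite basilica_aX1 => -[].
by move=> w; rewrite /= basilica_aX1 bv2.
Qed.

Let S (g : Gamma) := g = a \/ g = b.
Let H := elements basilica.

Lemma basilica_gen s : S s -> H s.
Proof. by case=> ->; apply: elements_gen; [left|right]. Qed.

Lemma basilica_ind P : is_subgroup P -> (forall s, S s -> P s) ->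
  forall x, H x -> P x.
Proof.
move=> sP PS; apply: elements_ind => // s [->|->]; apply: PS; [by left|by right].
Qed.

Let Ha : H a. Proof. by apply: basilica_gen; left. Qed.
Let Hb : H b. Proof. by apply: basilica_gen; right. Qed.

Lemma basilica_below1_conj_a x : below i1 x ^ (b ^+ 2) = below i1 (x ^ a).
Proof. by apply: below_conj => w; exact: basilica_bb. Qed.

Lemma basilica_below1_conj_b x : below i1 x ^ a = below i1 (x ^ b).
Proof. by apply: below_conj => w; exact: basilica_a1. Qed.

Lemma basilica_below0 x : below i1 x ^ b = below i0 x.
Proof. by rewrite -[x in RHS]conjg1; apply: below_conj => w; exact: basilica_b0. Qed.

Lemma basilica_aE_below : a = below i1 b.
Proof.
apply: bijectionP => -[//|y w]; elim/ord2P: y.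
  by rewrite abE below_out.
by rewrite abE below_in.
Qed.

(** Indeed b^2 = (a, a) and a = (1, b). *)
Lemma basilica_below1_commutator : below i1 [~ a, b] = [~ b ^+ 2, a].
Proof.
rewrite commgEr gmulfM [X in X * _]/= -basilica_below1_conj_a.
by rewrite gmulfV /= -basilica_aE_below -commgEr.
Qed.

(** The elements a and b^2 fix the letter 1 with sections b and a, so
    conjugation by them realizes there conjugation by the generators. *)
Lemma basilica_below1 x : derived H x -> derived H (below i1 x).
Proof.
have sH : is_subgroup H by exact: elements_subgroup.
have D1 : derived H 1 by rewrite -(commgg a); constructor.
apply: (@derived_branching _ H S sH basilica_ind basilica_gen (below i1)).
  move=> s [->|->]; [exists (b ^+ 2)|exists a] => //.
  - exact: subgroup_exp.
  - exact: basilica_below1_conj_a.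
  - exact: basilica_below1_conj_b.
have Dab : derived H (below i1 [~ a, b]).
  by rewrite basilica_below1_commutator; constructor => //; exact: subgroup_exp.
move=> s t [->|->] [->|->]; rewrite ?commgg ?gmulf1 //.
by rewrite -invgR gmulfV; exact: derived_inv.
Qed.

Lemma basilica_not_power_commutation : ~ power_commutation basilica.
Proof.
have sH : is_subgroup H by exact: elements_subgroup.
apply: (@not_power_commutation _ basilica (derived H) a [~ a, b]).
- by move=> x; exact: derived_sub.
- elim/ord2P; last exact: basilica_below1.
  move=> x Dx; rewrite -basilica_below0.
  by apply: derived_conj => //; exact: basilica_below1.
- by constructor.
- move=> k k0 abk.
  (* At the letter 1, [a, b] has section b^-1, of infinite order. *)
  have y1 w : [~ a, b] (i1 :: w) = i1 :: b^-1 w.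
    rewrite commgEl bij_mulE.
    have -> : (a ^ b) (i1 :: w) = i1 :: w.
      by apply: (can_inj (bij_funK b)); rewrite conj_app !abE.
    by apply: (can_inj (bij_funK a)); rewrite -bij_mulE mulgV basilica_a1 -bij_mulE mulgV.
  have yk w n : ([~ a, b] ^+ n) (i1 :: w) = i1 :: (b^-1 ^+ n) w.
    by elim: n => // n IH; rewrite !expgS bij_mulE IH y1.
  apply: (basilica_b_order k0); rewrite -[b]invgK expVgn -[RHS]invg1; congr (_^-1).
  apply: bijectionP => w; have := congr1 (fun g : Gamma => g (i1 :: w)) abk.
  by rewrite yk => -[].
- exact: Ha.
- exact: basilica_a_shrinks.
Qed.

End Basilica.

(** * The Hanoi Towers group on three pegs *)

Section Hanoi.

Definition hanoi_swap m (i j : 'I_m) : bijection (seq 'I_m) :=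
  val (hanoi_generator i j).

Section Swap.
Variables (m : nat) (i j : 'I_m).

Lemma hanoi_swapL w : hanoi_swap i j (i :: w) = j :: w.
Proof. by rewrite /hanoi_swap hanoi_generatorE eqxx tpermL. Qed.

Lemma hanoi_swapR w : hanoi_swap i j (j :: w) = i :: w.
Proof. by rewrite /hanoi_swap hanoi_generatorE eqxx orbT tpermR. Qed.

Lemma hanoi_swapD k w : k != i -> k != j ->
  hanoi_swap i j (k :: w) = k :: hanoi_swap i j w.
Proof.
move=> ki kj; rewrite /hanoi_swap hanoi_generatorE (negbTE ki) (negbTE kj) /=.
by rewrite tpermD // eq_sym.
Qed.

Lemma hanoi_swapK : involutive (hanoi_swap i j).
Proof.
elim=> // k w IH; have [->|ki] := eqVneq k i; first by rewrite hanoi_swapL hanoi_swapR.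
have [->|kj] := eqVneq k j; first by rewrite hanoi_swapR hanoi_swapL.
by rewrite (hanoi_swapD w ki kj) hanoi_swapD // IH.
Qed.

Lemma hanoi_swap2 : hanoi_swap i j * hanoi_swap i j = 1.
Proof. by apply: bijectionP => w; exact: hanoi_swapK. Qed.

Lemma hanoi_swapV : (hanoi_swap i j)^-1 = hanoi_swap i j.
Proof. by apply: mulg1_eq; exact: hanoi_swap2. Qed.

End Swap.

Lemma hanoi_swapC m (i j : 'I_m) : hanoi_swap i j = hanoi_swap j i.
Proof.
apply: bijectionP; elim=> // k w IH.
have [->|ki] := eqVneq k i; first by rewrite hanoi_swapL hanoi_swapR.
have [->|kj] := eqVneq k j; first by rewrite hanoi_swapR hanoi_swapL.
by rewrite (hanoi_swapD w ki kj) (hanoi_swapD w kj ki) IH.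
Qed.

Let H := elements (hanoi 3).
Let subH : is_subgroup H. Proof. exact: elements_subgroup. Qed.

Lemma hanoi_swap_in (i j : 'I_3) : i != j -> H (hanoi_swap i j).
Proof.
move=> ij; wlog lt : i j ij / (i < j)%N => [IH|].
  have [|lt|/val_inj eq] := ltngtP i j; first exact: IH.
    by rewrite hanoi_swapC; apply: IH => //; rewrite eq_sym.
  by rewrite eq eqxx in ij.
by apply: elements_gen; exists i, j.
Qed.

(** This automorphism fixes q with trivial section and exchanges p and r; its
    square has at p a section of the same form, for the order p, r, q. *)
Definition hanoi_triple (p q r : 'I_3) :=
  hanoi_swap q r * hanoi_swap p r * hanoi_swap p q.

(** Below p, q, r are the three pegs in an arbitrary order, and A, B, C the
    generators fixing p, q, r respectively. *)
Section Pegs.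
Variables p q r : 'I_3.
Hypothesis pegs : uniq [:: p; q; r].

Let pq : p != q. Proof. by move: pegs; rewrite /= !inE negb_or => /andP[/andP[]]. Qed.
Let pr : p != r. Proof. by move: pegs; rewrite /= !inE negb_or => /andP[/andP[]]. Qed.
Let qr : q != r. Proof. by move: pegs; rewrite /= !inE => /and3P[]. Qed.

Lemma pegsP (P : 'I_3 -> Prop) : P p -> P q -> P r -> forall x, P x.
Proof.
move=> Pp Pq Pr x; suff : x \in [:: p; q; r].
  by rewrite !inE => /or3P[] /eqP->.
have card_pegs : #|[:: p; q; r]| = #|'I_3| by rewrite (card_uniqP pegs) card_ord.
have /(subset_cardP card_pegs) -> : [:: p; q; r] \subset 'I_3; last by [].
exact/fintype.subsetP.
Qed.

Let A := hanoi_swap q r.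
Let B := hanoi_swap p r.
Let C := hanoi_swap p q.

Let Ap w : A (p :: w) = p :: A w. Proof. exact: hanoi_swapD. Qed.
Let Aq w : A (q :: w) = r :: w. Proof. exact: hanoi_swapL. Qed.
Let Ar w : A (r :: w) = q :: w. Proof. exact: hanoi_swapR. Qed.
Let Bp w : B (p :: w) = r :: w. Proof. exact: hanoi_swapL. Qed.
Let Bq w : B (q :: w) = q :: B w. Proof. by apply: hanoi_swapD; rewrite // eq_sym. Qed.
Let Br w : B (r :: w) = p :: w. Proof. exact: hanoi_swapR. Qed.
Let Cp w : C (p :: w) = q :: w. Proof. exact: hanoi_swapL. Qed.
Let Cq w : C (q :: w) = p :: w. Proof. exact: hanoi_swapR. Qed.
Let Cr w : C (r :: w) = r :: C w. Proof. by apply: hanoi_swapD; rewrite eq_sym. Qed.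
Let actE := (Ap, Aq, Ar, Bp, Bq, Br, Cp, Cq, Cr).
Let AK : involutive A. Proof. exact: hanoi_swapK. Qed.
Let BK : involutive B. Proof. exact: hanoi_swapK. Qed.
Let CK : involutive C. Proof. exact: hanoi_swapK. Qed.
Let HA : H A. Proof. exact: hanoi_swap_in. Qed.
Let HB : H B. Proof. exact: hanoi_swap_in. Qed.
Let HC : H C. Proof. exact: hanoi_swap_in. Qed.
Let HM x y : H x -> H y -> H (x * y). Proof. by have [_ + _] := subH; apply. Qed.

(** A B permutes the pegs cyclically, and going once around the cycle composes
    one section A with one section B. *)
Lemma hanoi_rotation_exp3 n w : ((A * B) ^+ (3 * n)) (p :: w) = p :: ((A * B) ^+ n) w.
Proof.
rewrite expgnA; apply: exp_section => {}w.
by rewrite !expgS expg0 mulg1 !bij_mulE !actE.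
Qed.

Lemma hanoi_rotation_order n : (0 < n)%N -> (A * B) ^+ n <> 1.
Proof.
elim/ltn_ind: n => n IH n0 ABn.
have := congr1 (fun g : bijection (seq 'I_3) => g (p :: [::])) ABn.
move: ABn; rewrite (divn_eq n 3) mulnC; have := ltn_pmod n (isT : (0 < 3)%N).
have := divn_eq n 3; move: (n %/ 3)%N (n %% 3)%N => m [|[|[|//]]] nE _ ABn /=.
- move=> _; apply: (IH m); [lia|lia|]; apply: bijectionP => w.
  have := congr1 (fun g : bijection (seq 'I_3) => g (p :: w)) ABn.
  by rewrite addn0 hanoi_rotation_exp3 => -[].
- rewrite addn1 expgS (bij_mulE _ (_ ^+ _)) hanoi_rotation_exp3 !bij_mulE !actE.
  by move=> [/eqP]; rewrite eq_sym (negbTE pq).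
- rewrite addn2 !expgS !(bij_mulE (A * B)) hanoi_rotation_exp3 !bij_mulE !actE.
  by move=> [/eqP]; rewrite eq_sym (negbTE pr).
Qed.

Definition peg_swap (g : bijection (seq 'I_3)) := [\/ g = A, g = B | g = C].

Lemma peg_swap_in s : peg_swap s -> H s. Proof. by case=> ->. Qed.

Lemma peg_swap_ind P : is_subgroup P -> (forall s, peg_swap s -> P s) ->
  forall x, H x -> P x.
Proof.
move=> sP PS; apply: elements_ind => // _ [i [j [ij ->]]].
rewrite -/(hanoi_swap i j); have {ij} : i != j by rewrite neq_ltn ij.
have PA : P A by apply: PS; constructor 1.
have PB : P B by apply: PS; constructor 2.
have PC : P C by apply: PS; constructor 3.
by elim/pegsP: i; elim/pegsP: j; rewrite ?eqxx // hanoi_swapC.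
Qed.

(** The elements B A B, A B A and C fix r with sections A, B and C. *)
Lemma hanoi_lift s : peg_swap s -> exists2 t, H t &
  forall x, below r x ^ t = below r (x ^ s).
Proof.
case=> ->.
- exists (B * A * B); first by do ?apply: HM.
  by move=> x; apply: below_conj => w; rewrite !bij_mulE !actE.
- exists (A * B * A); first by do ?apply: HM.
  by move=> x; apply: below_conj => w; rewrite !bij_mulE !actE.
- by exists C => // x; apply: below_conj => w; rewrite !actE.
Qed.

Let AV : A^-1 = A. Proof. exact: hanoi_swapV. Qed.
Let BV : B^-1 = B. Proof. exact: hanoi_swapV. Qed.
Let CV : C^-1 = C. Proof. exact: hanoi_swapV. Qed.
Let gE := (@commgEl (bijection (seq 'I_3)), @conjgE (bijection (seq 'I_3)),
  @invgM (bijection (seq 'I_3)), AV, BV, CV).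

Lemma below_eq (g h : bijection (seq 'I_3)) : g [::] = [::] ->
  (forall w, g (p :: w) = p :: w) -> (forall w, g (q :: w) = q :: w) ->
  (forall w, g (r :: w) = r :: h w) -> g = below r h.
Proof.
move=> g0 gp gq gr; apply: bijectionP => -[//|x w]; elim/pegsP: x.
- by rewrite below_out.
- by rewrite below_out.
- by rewrite below_in.
Qed.

(** A B A C is (A, A, B C) in the order p, q, r. As the generators are
    involutions, its square is (1, 1, [B, C]), and it is the commutator of A B A
    and C. *)
Lemma below_BC : [~ A * B * A, C] = below r [~ B, C].
Proof.
by apply: below_eq => [|w|w|w]; rewrite // !gE !bij_mulE !actE ?AK.
Qed.

Lemma below_AC : [~ B * A * B, C] = below r [~ A, C].
Proof.
by apply: below_eq => [|w|w|w]; rewrite // !gE !bij_mulE !actE ?BK.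
Qed.

Let P := A * B * A.
Let Z := C * A * C * A * C.

(** The squares above only give commutators with C below r; this word gives the
    remaining commutator of generators. The left-hand side is the product of the
    two conjugates A B A and Z B Z of B, with Z a palindrome; it is trivial at p
    and q, and its section B C A B A C at r equals B A B A = [B, A] up to the
    commutator of P and C. *)
Lemma below_AB : [~ P, A * Z] = below r ([~ B, A] * [~ P, C]).
Proof.
apply: below_eq => [|w|w|w]; rewrite // /P /Z !gE !bij_mulE !actE;
  by rewrite ?AK ?BK ?CK ?AK.
Qed.

Lemma hanoi_below_derived x : derived H x -> derived H (below r x).
Proof.
have HP : H P by do ?apply: HM.
have HZ : H Z by do ?apply: HM.
have D1 : derived H 1 by rewrite -(commgg A); constructor.
have DBC : derived H (below r [~ B, C]).
  by rewrite -below_BC; constructor => //; do ?apply: HM.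
have DAC : derived H (below r [~ A, C]).
  by rewrite -below_AC; constructor => //; do ?apply: HM.
have DC y : H y -> derived H (below r [~ y, C]).
  move=> Hy; apply: derived_delta_sym; move: y Hy.
  apply: (derived_delta_commutator subH peg_swap_ind peg_swap_in hanoi_lift) => // s [] ->.
  - exact: derived_delta_sym.
  - exact: derived_delta_sym.
  - by rewrite commgg gmulf1.
have DBA : derived H (below r [~ B, A]).
  rewrite -[[~ B, A]](mulgK [~ P, C]) gmulfM gmulfV /= -below_AB.
  apply: derived_mul; first by constructor => //; exact: HM.
  by apply: derived_inv; exact: DC.
apply: (derived_branching subH peg_swap_ind peg_swap_in hanoi_lift).
move=> s t [->|->|->] [->|->|->]; rewrite ?commgg ?gmulf1 //;
  exact: derived_delta_sym.
Qed.

Lemma hanoi_triple_expp n w :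
  (hanoi_triple p q r ^+ (2 * n)) (p :: w) = p :: (hanoi_triple p r q ^+ n) w.
Proof.
rewrite expgnA; apply: exp_section => {}w.
by rewrite expgS expg1 /hanoi_triple (hanoi_swapC r q) !bij_mulE !actE.
Qed.

Lemma hanoi_triple_expq n w : (hanoi_triple p q r ^+ n) (q :: w) = q :: w.
Proof.
rewrite (@exp_section _ _ 1) ?expg1n // => {}w.
by rewrite /hanoi_triple !bij_mulE !actE.
Qed.

Lemma hanoi_triple_exp_odd n w :
  (hanoi_triple p q r ^+ (2 * n).+1) (p :: w) <> p :: w.
Proof.
rewrite expgS bij_mulE hanoi_triple_expp /hanoi_triple !bij_mulE !actE.
by move=> [/eqP]; rewrite eq_sym (negbTE pr).
Qed.

Lemma hanoi_triple_in : H (hanoi_triple p q r).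
Proof. by do ?apply: HM. Qed.

Lemma hanoi_rotation_commutator k : (0 < k)%N -> [~ A, B] ^+ k <> 1.
Proof.
move=> k0; have -> : [~ A, B] = (A * B) ^+ 2.
  by rewrite !gE expgS expg1 !mulgA.
by rewrite -expgnA; apply: hanoi_rotation_order; rewrite muln_gt0.
Qed.

Lemma hanoi_rotation_derived : derived H [~ A, B].
Proof. by constructor. Qed.

End Pegs.

(** For odd N the N-th power exchanges p and r, and its square has at p the
    section (hanoi_triple p r q)^N, which is trivial below r. The even case
    reduces to N / 2 by passing to the section at p. *)
Lemma hanoi_triple_shrinks N p q r : (0 < N)%N -> uniq [:: p; q; r] ->
  exists2 v, (hanoi_triple p q r ^+ N) v <> v &
    forall w, (hanoi_triple p q r ^+ (N * 2)) (v ++ w) = v ++ w.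
Proof.
elim/ltn_ind: N p q r => N IH p q r N0 pqr.
have prq : uniq [:: p; r; q].
  by move: pqr; rewrite /= !inE !negb_or [r == q]eq_sym [(p != r) && _]andbC.
have [[m NE]|[m NE]] := even_or_odd N; last first.
  exists [:: p; r]; first by rewrite NE; exact: hanoi_triple_exp_odd.
  by move=> w; rewrite mulnC /= (hanoi_triple_expp pqr) hanoi_triple_expq.
have [|||v fv fv2] := IH m _ p r q; [lia|lia|done|].
exists (p :: v); first by rewrite NE (hanoi_triple_expp pqr) => -[].
by move=> w; rewrite NE -mulnA /= (hanoi_triple_expp pqr) fv2.
Qed.

Lemma hanoi3_not_power_commutation : ~ power_commutation (hanoi 3).
Proof.
pose x0 := @Ordinal 3 0 isT; pose x1 := @Ordinal 3 1 isT; pose x2 := @Ordinal 3 2 isT.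
have x012 : uniq [:: x0; x1; x2] by [].
apply: (@not_power_commutation _ (hanoi 3) (derived H) (hanoi_triple x0 x1 x2)
         [~ hanoi_swap x1 x2, hanoi_swap x0 x2]).
- by move=> x; exact: derived_sub.
- elim/(pegsP x012) => x.
  + exact: (@hanoi_below_derived x1 x2).
  + exact: (@hanoi_below_derived x0 x2).
  + exact: (@hanoi_below_derived x0 x1).
- exact: (hanoi_rotation_derived x012).
- exact: (hanoi_rotation_commutator x012).
- exact: (hanoi_triple_in x012).
- by move=> N N0; exact: hanoi_triple_shrinks.
Qed.

End Hanoi.

(** * Three pegs among m *)

Section Widen.
Variables (m : nat) (m3 : (3 <= m)%N).

Let wide : 'I_3 -> 'I_m := widen_ord m3.
Let narrow (x : 'I_m) : option 'I_3 := insub (val x).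

Definition small_letters (s : seq 'I_m) : seq 'I_3 := pmap narrow s.

(** The generators swapping two of the first three pegs ignore the other
    letters: they act on the subword of s formed by its first three letters, and
    [refill] puts the result back in the places of these letters. *)
Fixpoint refill (s : seq 'I_m) (t : seq 'I_3) : seq 'I_m :=
  if s is x :: s' then
    if narrow x is Some _ then
      if t is y :: t' then wide y :: refill s' t' else x :: refill s' t
    else x :: refill s' t
  else [::].

Let narrowK x : narrow (wide x) = Some x.
Proof. by rewrite /narrow /= valK. Qed.

Lemma narrowP x : if narrow x is Some y then x = wide y else forall y, x != wide y.
Proof.
rewrite /narrow; case: insubP => [y _ yx|xN]; first exact: val_inj.
by move=> y; apply: contra xN => /eqP ->; exact: (ltn_ord y).
Qed.

Lemma small_letters_refill s t : size t = size (small_letters s) ->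
  small_letters (refill s t) = t.
Proof.
elim: s t => [|x s IH] t /=; first by case: t.
case nx : (narrow x) => [y|] /=; last by rewrite nx; exact: IH.
by case: t => //= z t [st]; rewrite narrowK /= IH.
Qed.

Lemma refill_small_letters s : refill s (small_letters s) = s.
Proof.
elim: s => //= x s IH; have := narrowP x.
by case: (narrow x) => [y ->|_] /=; rewrite IH.
Qed.

Lemma refill_refill s t t' : size t = size (small_letters s) ->
  size t' = size (small_letters s) -> refill (refill s t) t' = refill s t'.
Proof.
elim: s t t' => [|x s IH] t t' //=.
case nx : (narrow x) => [y|] /=; last by move=> st st'; rewrite nx IH.
case: t => //= z t [st]; rewrite narrowK /=.
by case: t' => //= z' t' [st']; rewrite IH.
Qed.

Lemma refill_map_wide (u t : seq 'I_3) : size t = size u ->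
  small_letters (map wide u) = u /\ refill (map wide u) t = map wide t.
Proof.
elim: u t => [|x u IH] [|y t] //= [ut]; have [uE rE] := IH t ut.
by rewrite narrowK /= rE; split=> //; congr (_ :: _).
Qed.

Lemma hanoi_swap_refill i j s :
  hanoi_swap (wide i) (wide j) s = refill s (hanoi_swap i j (small_letters s)).
Proof.
have wide_inj : injective wide by move=> x y /(congr1 val) /= /val_inj.
elim: s => // x s IH; have := narrowP x; case nx : (narrow x) => [y|] xE.
- have -> : small_letters (x :: s) = y :: small_letters s by rewrite /= nx.
  rewrite {}xE in nx *.
  have [->|yi] := eqVneq y i.
    by rewrite !hanoi_swapL /= narrowK refill_small_letters.
  have [->|yj] := eqVneq y j.
    by rewrite !hanoi_swapR /= narrowK refill_small_letters.
  rewrite (hanoi_swapD _ yi yj) hanoi_swapD ?(inj_eq wide_inj) //.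
  by rewrite IH [RHS]/= nx.
- have -> : small_letters (x :: s) = small_letters s by rewrite /= nx.
  by rewrite hanoi_swapD // IH [RHS]/= nx.
Qed.

Definition refills (b : bijection (seq 'I_3)) (y : hanoi m) :=
  forall s, val (val y) s = refill s (b (small_letters s)).

(** Preservation of length is carried along, since refilling can only be undone
    with a word of the right length. *)
Lemma elements_refill b : elements (hanoi 3) b -> exists y, refills b y.
Proof.
move=> Hb; suff [] : (forall s, size (b s) = size s) /\ exists y, refills b y by [].
elim/elements_ind: Hb.
- split.
  + by split=> //; exists 1 => s; rewrite refill_small_letters.
  + move=> b1 b2 [sb1 [y1 y1E]] [sb2 [y2 y2E]]; split.
      by move=> s; rewrite bij_mulE sb1 sb2.
    exists (y1 * y2) => s; rewrite !gmulfM !bij_mulE y2E y1E.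
    by rewrite small_letters_refill // refill_refill // sb1 ?sb2.
  + move=> b1 [sb1 [y1 y1E]].
    have sb1V s : size (b1^-1 s) = size s by rewrite -sb1 -bij_mulE mulgV.
    split=> //; exists y1^-1 => s.
    apply: (can_inj (bij_funK (val (val y1)))).
    rewrite [RHS]y1E small_letters_refill // refill_refill // ?sb1 //.
    rewrite -(bij_mulE b1) mulgV refill_small_letters !gmulfV.
    exact: bij_invK.
- move=> _ [i [j [ij ->]]]; split; first exact: tree_aut_size.
  have [y yE] : elements (hanoi m) (val (hanoi_generator (wide i) (wide j))).
    by apply: elements_gen; exists (wide i), (wide j).
  by exists y => s; rewrite yE; exact: hanoi_swap_refill.
Qed.

Lemma hanoi3_embeds : embeds (hanoi 3) (hanoi m).
Proof.
have /boolp.choice[phi phiE] : forall x : hanoi 3, exists y, refills (val (val x)) y.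
  by move=> x; apply: elements_refill; exists x.
have phiM : {morph phi : x y / x * y}.
  move=> x y; do 2 apply: val_inj; apply: bijectionP => s.
  rewrite phiE !gmulfM !bij_mulE !phiE.
  by rewrite small_letters_refill ?refill_refill ?tree_aut_size.
pose phi' : {multiplicative hanoi 3 -> hanoi m} :=
  HB.pack phi (isMultiplicative.Build _ _ phi phiM).
exists phi' => x y xy; do 2 apply: val_inj; apply: bijectionP => u.
have := phiE y (map wide u); rewrite -[phi y]xy /= phiE.
have [-> rx] := refill_map_wide (tree_aut_size (val x) u).
have [_ ->] := refill_map_wide (tree_aut_size (val y) u).
by rewrite rx => /inj_map; apply=> a b /(congr1 val) /= /val_inj.
Qed.

End Widen.

Theorem theoremE :
  ~ embeds basilica thompsonV /\
  forall m : nat, (3 <= m)%N -> ~ embeds (hanoi m) thompsonV.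
Proof.
have PV := thompsonV_power_commutation; split=> [embB|m m3 embH].
  exact: basilica_not_power_commutation (power_commutation_embeds embB PV).
apply: hanoi3_not_power_commutation; apply: power_commutation_embeds PV.
exact: embeds_trans (hanoi3_embeds m3) embH.
Qed.
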